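(* Let $c_1,c_2,c_3$ be positive constants and let $\alpha\in(0,1]$. Suppose that a sequence $\{y(n)\}$ satisfies $$ y(n)\le c_1+c_2\sum_{m=0}^{n-1}y^\alpha(m)+c_3\sum_{m=0}^{n-1}y(m),\qquad n\ge1. $$ Then $$ y(n)\le c_1\bigg(1+\big(c_1^{\alpha-1}c_2+c_3\big)\frac{(1+\alpha c_1^{\alpha-1}c_2+c_3)^n-1}{\alpha c_1^{\alpha-1}c_2+c_3}\bigg),\qquad n\ge1. $$
   Context: The sequence $\{y(n)\}$ is indexed by the integers $n\ge0$, and $y^\alpha(m)$ denotes $(y(m))^\alpha$.
   Formalization: The formal version assumes y(n) ≥ 0 for all n (so that y^α makes sense) and adds y(0) ≤ c_1, the inequality at n = 0; without the latter the claim fails, e.g. c_1=c_2=c_3=α=1, y(0)=10, y(1)=21, y(n)=0 for n≥2, where the bound at n=1 is 3. *)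

(* Defs.v *)
From mathcomp Require Export all_boot all_order all_algebra.
From mathcomp Require Export reals exp.

(* Main.v *)
Require Import Defs.
From mathcomp Require Import ring lra.

Import Order.TTheory GRing.Theory Num.Theory.
Local Open Scope ring_scope.

(** Since [alpha <= 1], the graph of [t |-> t `^ alpha] lies below its tangent
    line at [c1] ([powR_le_tangent]).  Replacing the power by this line turns
    the nonlinear hypothesis into an affine one,
    [y n <= c1 + \sum_(m < n) (p + q * y m)], with
    [q = alpha * c1 `^ (alpha - 1) * c2 + c3] and
    [p = (1 - alpha) * c1 `^ (alpha - 1) * c2 * c1].  An affine summation
    inequality with positive slope is dominated by the solution of the
    corresponding equation, which is a geometric sequence up to an affine change
    of variable ([affine_gronwall]).  The tangent point [c1] is also the initial
    value, so [p + q * c1 = c1 * (c1 `^ (alpha - 1) * c2 + c3)], and this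
    produces exactly the stated constants. *)

(** Bernoulli's inequality for real exponents is Young's inequality for
    [t `^ alpha] and [1], with conjugate exponents [alpha^-1] and
    [(1 - alpha)^-1]. *)
Lemma powR_bernoulli (R : realType) (alpha t : R) :
  0 < alpha -> alpha <= 1 -> 0 <= t -> t `^ alpha <= 1 + alpha * (t - 1).
Proof.
move=> a0 a1 t0.
(* For [alpha = 1] the conjugate exponent is infinite. *)
have [->|a_neq1] := eqVneq alpha 1; first by rewrite powRr1// mul1r subrKC.
have b0 : 0 < 1 - alpha by rewrite subr_gt0 lt_neqAle a_neq1.
have := @conjugate_powR _ (t `^ alpha) 1 alpha^-1 (1 - alpha)^-1
  (powR_ge0 _ _) ler01.
rewrite !invr_gt0 !invrK subrKC -powRrM divff ?gt_eqF// powRr1// powR1.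
move=> /(_ a0 b0 erefl); lra.
Qed.

(** Bernoulli's inequality for [t / c], scaled by [c `^ alpha]; the tangent line
    at [c] is written here with [c `^ (alpha - 1)] factored out. *)
Lemma powR_le_tangent (R : realType) (alpha c t : R) :
  0 < alpha -> alpha <= 1 -> 0 < c -> 0 <= t ->
  t `^ alpha <= c `^ (alpha - 1) * ((1 - alpha) * c + alpha * t).
Proof.
move=> a0 a1 c0 t0.
have tc0 : 0 <= t / c by rewrite divr_ge0// ltW.
have -> : t `^ alpha = c `^ alpha * (t / c) `^ alpha.
  by rewrite -powRM ?(ltW c0)// mulrC divfK// gt_eqF.
rewrite -[c `^ alpha](mulr_powRB1 (ltW c0) a0) [c * _]mulrC -mulrA.
rewrite ler_wpM2l ?powR_ge0//.
have -> : (1 - alpha) * c + alpha * t = c * (1 + alpha * (t / c - 1)).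
  by field; rewrite gt_eqF.
by rewrite ler_wpM2l ?(ltW c0)// powR_bernoulli.
Qed.

(** The bound [B n] on the right satisfies the hypothesis with equality: its
    increment [B n.+1 - B n] is [(p + q * c) * (1 + q) ^+ n = p + q * B n].
    As [q] is positive, the right-hand side of the hypothesis is monotone in the
    earlier terms, so the domination of [y] by [B] propagates. *)
Lemma affine_gronwall (R : realFieldType) (c p q : R) (y : nat -> R) :
  0 < q ->
  (forall n, y n <= c + \sum_(0 <= m < n) (p + q * y m)) ->
  forall n, y n <= c + (p + q * c) * (((1 + q) ^+ n - 1) / q).
Proof.
move=> q0 hy; set B := fun n => c + (p + q * c) * (((1 + q) ^+ n - 1) / q).
have BE n : B n = c + \sum_(0 <= m < n) (p + q * B m).
  elim: n => [|n IHn]; first by rewrite /B big_geq// expr0 subrr mul0r mulr0.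
  rewrite big_nat_recr//= addrA -IHn /B exprS.
  by field; rewrite gt_eqF.
elim/ltn_ind => n IHn; rewrite -[leRHS]/(B n) BE.
apply: le_trans (hy n) _; rewrite lerD2l; apply: ler_sum_nat => m /= mn.
by rewrite lerD2l ler_wpM2l ?(ltW q0)//; apply: IHn.
Qed.

Theorem lemma2p2 (R : realType) (c1 c2 c3 alpha : R) (y : nat -> R)
    (hc1 : 0 < c1) (hc2 : 0 < c2) (hc3 : 0 < c3)
    (ha0 : 0 < alpha) (ha1 : alpha <= 1)
    (hy : forall n : nat, 0 <= y n)
    (hy0 : y 0%N <= c1)
    (hrec : forall n : nat, (1 <= n)%N ->
      y n <= c1 + c2 * (\sum_(0 <= m < n) y m `^ alpha)
                + c3 * (\sum_(0 <= m < n) y m)) :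
  forall n : nat, (1 <= n)%N ->
    y n <= c1 * (1 + (c1 `^ (alpha - 1) * c2 + c3)
      * (((1 + alpha * c1 `^ (alpha - 1) * c2 + c3) ^+ n - 1)
         / (alpha * c1 `^ (alpha - 1) * c2 + c3))).
Proof.
set A := c1 `^ (alpha - 1); set q := alpha * A * c2 + c3.
have q0 : 0 < q by rewrite addr_gt0// !mulr_gt0// powR_gt0.
pose p : R := (1 - alpha) * A * c2 * c1.
have affine n : y n <= c1 + \sum_(0 <= m < n) (p + q * y m).
  (* At [n = 0] the sum is empty and the claim is the assumption on [y 0]. *)
  case: n => [|n]; first by rewrite big_geq// addr0.
  apply: le_trans (hrec n.+1 isT) _.
  rewrite -addrA lerD2l !mulr_sumr -big_split/=; apply: ler_sum => m _.
  have -> : p + q * y m = c2 * (A * ((1 - alpha) * c1 + alpha * y m))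
      + c3 * y m by rewrite /p /q; ring.
  by rewrite lerD2r ler_wpM2l ?(ltW hc2)// powR_le_tangent.
move=> n _; apply: le_trans (affine_gronwall _ _ _ _ _ q0 affine n) _.
rewrite -addrA -/q le_eqVlt; apply/orP; left; apply/eqP.
have -> : p + q * c1 = c1 * (A * c2 + c3) by rewrite /p /q; ring.
by rewrite [RHS]mulrDr mulr1 -mulrA.
Qed.
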